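(* Fix $\kappa\in\mathbb{R}$; if $\kappa\neq0$ let $k>0$ with $|\kappa|=4k^2$. Set $I=(0,\frac{\pi}{k})$ if $\kappa>0$ and $I=(0,\infty)$ otherwise. Let $G$ be the model space corresponding to $\kappa$ (as described in the context) with left-invariant orthonormal frame $(X_1,X_2)$ of the contact distribution, and consider the embedded surface $$S=\{\exp(r\cos\theta\,X_1+r\sin\theta\,X_2): r\in I,\ \theta\in[0,2\pi)\}.$$ Then in the coordinates $(r,\theta)$ the limiting operator $\Delta_0=\widehat{X}_S^2+b\,\widehat{X}_S$ on $S$ is $$\Delta_0=\frac{\partial^2}{\partial r^2}+b(r)\frac{\partial}{\partial r},\qquad b(r)=\begin{cases}2k\cot(kr)&\text{if }\kappa=4k^2,\\ \frac{2}{r}&\text{if }\kappa=0,\\ 2k\coth(kr)&\text{if }\kappa=-4k^2.\end{cases}$$ Consequently, the stochastic process induced by $\frac12\Delta_0$, moving along the leaves of the characteristic foliation of $S$ (the curves $\theta=\mathrm{const}$), is a Bessel process of order $3$ if $\kappa=0$, a Legendre process of order $3$ (on $(0,\pi/k)$) if $\kappa>0$, and a hyperbolic Bessel process of order $3$ if $\kappa<0$.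
   Context: General setting: for a three-dimensional contact sub-Riemannian manifold $(M,D,g)$ with contact form $\omega$ normalised by ${\mathrm d}\omega|_D=-\operatorname{vol}_g$, Reeb field $X_0$ (${\mathrm d}\omega(X_0,\cdot)=0$, $\omega(X_0)=1$), global oriented orthonormal frame $(X_1,X_2)$ of $D$, and a surface $S=\{u=0\}$ with $u\in C^2$, ${\mathrm d}u\ne0$ on $S$, the characteristic set is $\Gamma(S)=\{X_1u=X_2u=0\}$, and on $S\setminus\Gamma(S)$ one sets $\widehat{X}_S=\frac{(X_2u)X_1-(X_1u)X_2}{\sqrt{(X_1u)^2+(X_2u)^2}}$ and $b=\frac{X_0u}{\sqrt{(X_1u)^2+(X_2u)^2}}$ (these depend only on $S$, up to the choice of sign of $u$, and $\Delta_0$ does not depend on this choice). Model spaces: $G$ is a three-dimensional Lie group with contact sub-Riemannian structure whose distribution is spanned by left-invariant $g$-orthonormal vector fields $X_1,X_2$ with Reeb vector field $X_0$ satisfying $[X_1,X_2]=X_0$, $[X_0,X_1]=\kappa X_2$, $[X_0,X_2]=-\kappa X_1$. For $\kappa=0$: the Heisenberg group $\mathbb{R}^3$ with law $(x_1,y_1,z_1)*(x_2,y_2,z_2)=(x_1+x_2,y_1+y_2,z_1+z_2+\frac12(x_1y_2-x_2y_1))$, $X_1=\partial_x-\frac y2\partial_z$, $X_2=\partial_y+\frac x2\partial_z$. For $\kappa=4k^2$: ${\rm SU}(2)$ with $X_1,X_2$ the left-invariant vector fields corresponding to $k\,i\sigma_1$ and $k\,i\sigma_2$ ($\sigma_1,\sigma_2$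 Pauli matrices). For $\kappa=-4k^2$: ${\rm SL}(2,\mathbb{R})$ with $X_1,X_2$ the left-invariant vector fields corresponding to $k\begin{pmatrix}1&0\\0&-1\end{pmatrix}$ and $k\begin{pmatrix}0&1\\1&0\end{pmatrix}$. In each case $\exp$ is the group exponential, identifying a left-invariant vector field with its value at the identity. The Bessel process of order $3$, Legendre process of order $3$ and hyperbolic Bessel process of order $3$ are the diffusions with generators $\frac12\frac{d^2}{dr^2}+\frac1r\frac{d}{dr}$ on $(0,\infty)$, $\frac12\frac{d^2}{dr^2}+k\cot(kr)\frac{d}{dr}$ on $(0,\pi/k)$, and $\frac12\frac{d^2}{dr^2}+k\coth(kr)\frac{d}{dr}$ on $(0,\infty)$, respectively. *)

(* Defs.v *)
From HB Require Import structures.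
From mathcomp Require Import all_boot all_order all_algebra.
From mathcomp Require Import all_classical all_reals all_analysis.
From mathcomp Require complex.
Set Implicit Arguments. Unset Strict Implicit. Unset Printing Implicit Defensive.
Import Order.TTheory GRing.Theory Num.Theory.
Import numFieldNormedType.Exports.
Local Open Scope classical_set_scope.
Local Open Scope ring_scope.

Section Generic.
Variable R : realType.

Definition D1 (f : R -> R) : R -> R := @derive1 R R^o f.
Variable V : normedModType R.

Definition Xder (X : V -> V) (f : V -> R) : V -> R := fun p => 'D_(X p) f p.

Definition C2_on (U : set V) (f : V -> R) : Prop :=
  (forall p, U p -> differentiable f p) /\
  (forall (v : V) p, U p -> differentiable ('D_v f) p) /\
  (forall (v w : V) p, U p -> {for p, continuous ('D_w ('D_v f))}).

Definition hnorm (X1 X2 : V -> V) (u : V -> R) (p : V) : R :=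
  Num.sqrt (Xder X1 u p ^+ 2 + Xder X2 u p ^+ 2).

Definition Xhat (X1 X2 : V -> V) (u : V -> R) (f : V -> R) : V -> R :=
  fun p => (Xder X2 u p * Xder X1 f p - Xder X1 u p * Xder X2 f p)
           / hnorm X1 X2 u p.

Definition bS (X0 X1 X2 : V -> V) (u : V -> R) : V -> R :=
  fun p => Xder X0 u p / hnorm X1 X2 u p.

Definition Delta0 (X0 X1 X2 : V -> V) (u f : V -> R) : V -> R :=
  fun p => Xhat X1 X2 u (Xhat X1 X2 u f) p + bS X0 X1 X2 u p * Xhat X1 X2 u f p.

Definition expG (e : V) (X : V -> V) : V :=
  get [set p | exists gam : R -> V, gam 0 = e /\
        (forall t : R, is_derive t (1 : R) gam (X (gam t))) /\ gam 1 = p].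

Definition Phi (e : V) (X1 X2 : V -> V) (r th : R) : V :=
  expG e (fun p => (r * cos th) *: X1 p + (r * sin th) *: X2 p).

(** The statement of Theorem 1.5 for a given model space, presented inside
    the ambient normed space V: identity e, group G (a subset of V),
    left-invariant frame X0 X1 X2 (as vector fields on V), the interval I of
    the radial coordinate, the drift b(r), and the generator of the
    one-dimensional diffusion. *)
Definition Delta0_claim (e : V) (G : set V) (X0 X1 X2 : V -> V) (I : set R)
    (bb : R -> R) (gen : (R -> R) -> R -> R) : Prop :=
  let S := [set p | exists (r th : R), I r /\ 0 <= th < 2 * pi /\ p = Phi e X1 X2 r th] in
  forall (U : set V) (u F : V -> R),
    open U -> S `<=` U -> C2_on U u -> C2_on U F ->
    (forall p, U p -> G p -> (u p = 0 <-> S p)) ->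
    (forall p, S p ->
       (Xder X0 u p, Xder X1 u p, Xder X2 u p) <> (0, 0, 0)) ->
    forall r th : R, I r -> 0 <= th < 2 * pi ->
      let p := Phi e X1 X2 r th in
      let f := fun s => F (Phi e X1 X2 s th) in
      (Xder X1 u p != 0 \/ Xder X2 u p != 0) /\
      derivable f r 1 /\ derivable (D1 f) r 1 /\
      Delta0 X0 X1 X2 u F p = D1 (D1 f) r + bb r * D1 f r /\
      (2^-1) * Delta0 X0 X1 X2 u F p = gen f r.

End Generic.

Section Models.
Variable R : realType.

Definition bessel3_gen (f : R -> R) (r : R) : R :=
  2^-1 * D1 (D1 f) r + r^-1 * D1 f r.
Definition legendre3_gen (k : R) (f : R -> R) (r : R) : R :=
  2^-1 * D1 (D1 f) r + k * (cos (k * r) / sin (k * r)) * D1 f r.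
Definition hypbessel3_gen (k : R) (f : R -> R) (r : R) : R :=
  2^-1 * D1 (D1 f) r + k * ((expR (k * r) + expR (- (k * r))) /
                         (expR (k * r) - expR (- (k * r)))) * D1 f r.

Definition vec3 (a b c : R) : 'rV[R]_3 :=
  \row_(i < 3) (if i == 0 :> nat then a else if i == 1 :> nat then b else c).
Definition pX (p : 'rV[R]_3) := p 0 0.
Definition pY (p : 'rV[R]_3) := p 0 1.
Definition heisX1 (p : 'rV[R]_3) : 'rV[R]_3 := vec3 1 0 (- pY p / 2).
Definition heisX2 (p : 'rV[R]_3) : 'rV[R]_3 := vec3 0 1 (pX p / 2).
Definition heisX0 (p : 'rV[R]_3) : 'rV[R]_3 := vec3 0 0 1.

(** SL(2,R) inside 'M[R]_2; left-invariant field of A is g |-> g A. *)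
Definition linv (n : nat) (A : 'M[R]_n) : 'M[R]_n -> 'M[R]_n := fun g => g *m A.
Definition sl2A1 (k : R) : 'M[R]_2 := \matrix_(i < 2, j < 2)
  (if (i == 0 :> nat) && (j == 0 :> nat) then k
   else if (i == 1 :> nat) && (j == 1 :> nat) then - k else 0).
Definition sl2A2 (k : R) : 'M[R]_2 := \matrix_(i < 2, j < 2)
  (if i == j then 0 else k).
Definition SL2 : set 'M[R]_2 := [set g | \det g = 1].

(** SU(2) inside 'M[R[i]]_2, realified into 'M[R]_4 via
    P + iQ |-> [[P, -Q], [Q, P]]. *)
Import complex.
Local Open Scope complex_scope.
Definition realify (M : 'M[R[i]]_2) : 'M[R]_4 :=
  block_mx (map_mx (@Re R) M) (- map_mx (@Im R) M)
           (map_mx (@Im R) M) (map_mx (@Re R) M).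
Definition pauli1 : 'M[R[i]]_2 := \matrix_(i < 2, j < 2)
  (if i == j then 0 else 1).
Definition pauli2 : 'M[R[i]]_2 := \matrix_(i < 2, j < 2)
  (if i == j then 0 else if i == 0 :> nat then - 'i else 'i).
Definition su2A1 (k : R) : 'M[R]_4 := realify ((k%:C * 'i) *: pauli1).
Definition su2A2 (k : R) : 'M[R]_4 := realify ((k%:C * 'i) *: pauli2).
Definition SU2c : set 'M[R[i]]_2 :=
  [set M | M *m (map_mx conjc M)^T = 1 /\ \det M = 1].
Definition SU2 : set 'M[R]_4 := realify @` SU2c.

Definition commA (n : nat) (A B : 'M[R]_n.+1) : 'M[R]_n.+1 := A * B - B * A.

End Models.

(* Main.v *)
Require Import Defs.
From HB Require Import structures.
From mathcomp Require Import all_boot all_order all_algebra.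
From mathcomp Require Import all_classical all_reals all_analysis.
From mathcomp Require Import ring lra.
From mathcomp Require complex.
Set Implicit Arguments.
Unset Strict Implicit.
Unset Printing Implicit Defensive.
Import Order.TTheory GRing.Theory Num.Theory.
Import numFieldNormedType.Exports.
Local Open Scope classical_set_scope.
Local Open Scope ring_scope.

(** Write [P r th] for the exponential polar chart.  Its partial derivatives are
      [d_r P = cos th X1 + sin th X2]  and
      [d_th P = al r (- sin th X1 + cos th X2) - be r X0]
    with [be r <> 0].  As [u] vanishes on the surface, differentiating [u o P]
    yields [cos th X1 u + sin th X2 u = 0] and, with
    [N := - sin th X1 u + cos th X2 u], the relation [al N = be X0 u].  So [N]
    cannot vanish, the horizontal gradient of [u] has length [|N|], the field
    [Xhat] is [sg N * d_r], and [b = sg N * al / be].  The sign of [N] is locally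
    constant along a leaf and cancels in [Delta0], which leaves the drift
    [al / be].  In SL(2) and SU(2) the rescaled generators [J1, J2] anticommute
    and have the same square [eps = 1], resp. [eps = -1]; hence the chart is
    [C r + Sn r (cos th J1 + sin th J2)] with hyperbolic, resp. circular,
    functions [C] and [Sn]. *)

(** * Differentiability and directional derivatives of matrix-valued maps *)

Section Calculus.
Context {R : realType}.

(** Two functions that agree near [p] share their first-order expansion there, so ['d f p] also
    serves as the differential of [g], by uniqueness of the differential. *)
Lemma near_eq_differentiable (V W : normedModType R) (f g : V -> W) (p : V) :
  (\near p, f p = g p) -> differentiable f p -> differentiable g p.
Proof.
move=> fg df.
have fgp : f p = g p by exact: nbhs_singleton fg.
have dg0 : g \o shift p = cst (g p) + 'd f p +o_ 0 id.
  apply/eqaddoP => e e0.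
  have /eqaddoP/(_ _ e0) := diff_locally df.
  have := fg; rewrite (near_shift 0 p) => fg0.
  apply: filter_app; near=> h => H.
  have fgh : f (h + p) = g (h + p).
    by have : (f \o shift (p - 0)) h = (g \o shift (p - 0)) h;
      [near: h; exact: fg0 | rewrite /= subr0].
  by move: H; rewrite !fctE /= fgh fgp.
have Dgf : 'd g p = 'd f p :> (V -> W).
  by apply: diff_unique => //; exact: diff_continuous.
apply/diff_locallyP; rewrite Dgf; split=> //; exact: diff_continuous.
Unshelve. all: by end_near. Qed.

Lemma is_derive_along (V : normedModType R) (c : R -> V) (g : V -> R)
    (s : R) (v : V) :
  is_derive s (1 : R) c v -> differentiable g (c s) ->
  is_derive s (1 : R) (g \o c) ('D_v g (c s)).
Proof.
move=> [/derivable1_diffP dc <-] dg.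
have dgc : differentiable (g \o c) s by exact: differentiable_comp.
split; first exact/derivable1_diffP.
by rewrite (deriveE _ dgc) (deriveE _ dg) (deriveE _ dc) diff_comp.
Qed.

Lemma derive_lincomb (V : normedModType R) (g : V -> R) (p v w : V) (a b : R) :
  differentiable g p -> 'D_(a *: v + b *: w) g p = a * 'D_v g p + b * 'D_w g p.
Proof. by move=> dg; rewrite !deriveE // linearD !linearZ. Qed.

Lemma is_derive_mxP (m n : nat) (c : R -> 'M[R]_(m, n)) (s : R) (v : 'M[R]_(m, n)) :
  is_derive s (1 : R) c v <->
  forall i j, is_derive s (1 : R) (fun t => c t i j) (v i j).
Proof.
split=> [[dc dv] i j|H].
  split; first by move/derivable_mxP: dc; apply.
  by rewrite -dv derive_mx // mxE.
have dc : derivable c s 1 by apply/derivable_mxP => i j; have [] := H i j.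
by split=> //; rewrite derive_mx //; apply/matrixP => i j; rewrite mxE; have [] := H i j.
Qed.

Lemma differentiable_sqrt (V : normedModType R) (g : V -> R) (p : V) :
  differentiable g p -> 0 < g p -> differentiable (fun q => Num.sqrt (g q)) p.
Proof.
move=> dg g0; apply: (@differentiable_comp _ _ _ _ g Num.sqrt) => //.
by apply/derivable1_diffP; have [] := is_derive1_sqrt g0.
Qed.

(** Expanding [X q] in the basis [delta_mx i j] turns [Xder X u] into a finite sum of coefficients
    of [X] times partial derivatives of [u]. Linearity of the differential gives this only on [U],
    hence the appeal to locality. *)
Lemma differentiable_Xder (m n : nat) (X : 'M[R]_(m, n) -> 'M[R]_(m, n))
    (U : set 'M[R]_(m, n)) (u : 'M[R]_(m, n) -> R) (p : 'M[R]_(m, n)) :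
  (forall i j q, differentiable (fun q => X q i j) q) ->
  open U -> C2_on U u -> U p -> differentiable (Xder X u) p.
Proof.
move=> dX oU [du [du1 _]] Up.
pose h : 'M[R]_(m, n) -> R := \sum_(i < m) \sum_(j < n)
  ((fun q => X q i j) * ('D_(delta_mx i j) u)).
have hE q : h q = \sum_(i < m) \sum_(j < n) X q i j * 'D_(delta_mx i j) u q.
  rewrite /h fct_sumE; apply: eq_bigr => i _.
  by rewrite fct_sumE; apply: eq_bigr.
apply: (@near_eq_differentiable _ _ h); last first.
  apply: differentiable_sum => i; apply: differentiable_sum => j.
  apply: differentiableM => //; exact: du1.
have : \near p, U p by exact: open_nbhs_nbhs.
apply: filter_app; near=> q => Uq.
rewrite hE /Xder (deriveE _ (du _ Uq)) [in RHS](matrix_sum_delta (X q)).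
rewrite linear_sum; apply: eq_bigr => i _; rewrite linear_sum; apply: eq_bigr => j _.
by rewrite linearZ /= deriveE //; exact: du.
Unshelve. all: by end_near. Qed.

End Calculus.

(** * The operator in a general exponential polar chart *)

Section PolarChart.
Context {R : realType} {m n : nat}.
Notation V := 'M[R]_(m, n).

Lemma PhiD2pi (e : V) (X1 X2 : V -> V) (r th : R) :
  Phi e X1 X2 r (th + 2 * pi) = Phi e X1 X2 r th.
Proof. by rewrite /Phi mulr_natl cosD2pi sinD2pi. Qed.

(** The three geometries enter only through a closed form [P] of the chart and the two coefficients
    [al] and [be] of its angular derivative, so each model reduces to computing these. *)
Lemma Delta0_claim_polar (e : V) (G : set V) (X0 X1 X2 : V -> V) (I : set R)
    (bb : R -> R) (gen : (R -> R) -> R -> R) (P : R -> R -> V) (al be : R -> R) :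
  (forall i j q, differentiable (fun q => X1 q i j) q) ->
  (forall i j q, differentiable (fun q => X2 q i j) q) ->
  open I ->
  (forall r th, Phi e X1 X2 r th = P r th) ->
  (forall r th, I r -> G (P r th)) ->
  (forall r th, is_derive r (1 : R) (P^~ th)
     (cos th *: X1 (P r th) + sin th *: X2 (P r th))) ->
  (forall r th, is_derive th (1 : R) (P r)
     (al r *: (- sin th *: X1 (P r th) + cos th *: X2 (P r th))
      + (- be r) *: X0 (P r th))) ->
  (forall r, I r -> be r != 0) ->
  (forall r, I r -> bb r = al r / be r) ->
  (forall f r, gen f r = 2^-1 * (D1 (D1 f) r + bb r * D1 f r)) ->
  Delta0_claim e G X0 X1 X2 I bb gen.
Proof.
move=> dX1 dX2 oI PhiE PG dPr dPth be0 bbE genE S U u F oU SU Cu CF uS u0 r th Ir.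
move=> th02 /=.
have PhiEr : (fun s => F (Phi e X1 X2 s th)) = F \o P^~ th.
  by apply/funext => s /=; rewrite PhiE.
rewrite PhiEr genE.
(* The angles of [S] fill [[0, 2 pi)], but differentiating in the angle at [th = 0] needs a
   two-sided neighbourhood; periodicity supplies the negative angles. *)
have SP s t : I s -> - (2 * pi) < t < 2 * pi -> S (P s t).
  move=> Is /andP[t1 t2]; have [t0|t0] := leP 0 t.
    by exists s, t; rewrite PhiE t0.
  exists s, (t + 2 * pi); rewrite PhiD2pi PhiE; split=> //; split=> //.
  by apply/andP; split; lra.
have uP s t : I s -> - (2 * pi) < t < 2 * pi -> u (P s t) = 0.
  by move=> Is tb; apply/uS; [exact/SU/SP | exact: PG | exact: SP].
have pi0 : 0 < pi :> R by exact: pi_gt0.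
have thb : - (2 * pi) < th < 2 * pi by lra.
have UP s : I s -> U (P s th) by move=> Is; apply/SU/SP.
have du q : U q -> differentiable u q by case: Cu => + _; apply.
have dF q : U q -> differentiable F q by case: CF => + _; apply.
have cs1 : cos th ^+ 2 + sin th ^+ 2 = 1 by exact: cos2Dsin2.
have nI s : I s -> \near s, I s by move=> Is; exact: open_nbhs_nbhs.
pose N q := - sin th * Xder X1 u q + cos th * Xder X2 u q.
(* Radial derivative of [u] along the chart, where [u] vanishes; [K2] is the angular one. *)
have K1 s : I s -> cos th * Xder X1 u (P s th) + sin th * Xder X2 u (P s th) = 0.
  move=> Is; rewrite -derive_lincomb; last exact/du/UP.
  have [_ <-] := is_derive_along (dPr s th) (du _ (UP _ Is)).
  rewrite -(derive_cst (0 : R) s 1); apply: near_eq_derive.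
  have := nI _ Is; apply: filter_app; near=> t => It /=; exact: uP.
have K2 s : I s -> al s * N (P s th) = be s * Xder X0 u (P s th).
  move=> Is; apply/eqP; rewrite -subr_eq0; apply/eqP.
  rewrite -mulNr /N -derive_lincomb; last exact/du/UP.
  rewrite -derive_lincomb; last exact/du/UP.
  have [_ <-] := is_derive_along (dPth s th) (du _ (UP _ Is)).
  rewrite -(derive_cst (0 : R) th 1); apply: near_eq_derive.
  have : \near th, th \in `]- (2 * pi), (2 * pi)[%R.
    by apply: near_in_itvoo; rewrite in_itv.
  by apply: filter_app; near=> t; rewrite in_itv /= => tb; exact: uP.
(* In the frame rotated by [th], the horizontal gradient of [u] has components [0] (by [K1]) and
   [N]; rotating back recovers [X1 u], and likewise [X2 u] below. *)
have X1u s : I s -> Xder X1 u (P s th) = - sin th * N (P s th).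
  move=> Is; have := K1 _ Is; rewrite /N.
  set a := Xder X1 u _; set b := Xder X2 u _ => K.
  transitivity ((cos th ^+ 2 + sin th ^+ 2) * a); first by rewrite cs1 mul1r.
  have -> : (cos th ^+ 2 + sin th ^+ 2) * a =
    cos th * (cos th * a + sin th * b) - sin th * (- sin th * a + cos th * b) by ring.
  by rewrite K; ring.
have X2u s : I s -> Xder X2 u (P s th) = cos th * N (P s th).
  move=> Is; have := K1 _ Is; rewrite /N.
  set a := Xder X1 u _; set b := Xder X2 u _ => K.
  transitivity ((cos th ^+ 2 + sin th ^+ 2) * b); first by rewrite cs1 mul1r.
  have -> : (cos th ^+ 2 + sin th ^+ 2) * b =
    sin th * (cos th * a + sin th * b) + cos th * (- sin th * a + cos th * b) by ring.
  by rewrite K; ring.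
(* If [N] vanished, so would [X1 u] and [X2 u], and then [X0 u] by [K2] since [be] is nonzero,
   against [u0]. *)
have N0 s : I s -> N (P s th) != 0.
  move=> Is; apply/eqP => N0; apply: (u0 (P s th)); first exact: SP.
  rewrite X1u // X2u // N0 !mulr0; congr (_, _, _); apply/eqP.
  by have /esym/eqP := K2 _ Is; rewrite N0 mulr0 mulf_eq0 (negPf (be0 _ Is)).
have hn s : I s -> hnorm X1 X2 u (P s th) = `|N (P s th)|.
  move=> Is; rewrite /hnorm X1u // X2u // -sqrtr_sqr; congr Num.sqrt.
  by rewrite !exprMn sqrrN -mulrDl addrC cs1 mul1r.
pose Y (g : V -> R) q := cos th * Xder X1 g q + sin th * Xder X2 g q.
have XhatE g s : I s -> Xhat X1 X2 u g (P s th) = Num.sg (N (P s th)) * Y g (P s th).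
  move=> Is; rewrite /Xhat hn // X1u // X2u //.
  have nN : `|N (P s th)| != 0 by rewrite normr_eq0 N0.
  apply: (mulIf nN); rewrite divfK // [RHS]mulrAC.
  by rewrite -numEsg /Y; ring.
have fder g s : I s -> differentiable g (P s th) ->
    is_derive s (1 : R) (g \o P^~ th) (Y g (P s th)).
  by move=> Is dg; rewrite /Y -derive_lincomb //; exact: is_derive_along.
(* The equality is needed on a whole neighbourhood of [r], because it is differentiated once more to
   get [D2E]. *)
have dD1 : \near r, Y F (P r th) = D1 (F \o P^~ th) r.
  have := nI _ Ir; apply: filter_app; near=> s => Is.
  by rewrite /D1 derive1E; have [_ ->] := fder F s Is (dF _ (UP _ Is)).
have dYF : differentiable (Y F) (P r th).
  rewrite /Y; apply: differentiableD; apply: differentiableM => //;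
    apply: (differentiable_Xder (U := U)) => //; exact: UP.
have dN : differentiable N (P r th).
  rewrite /N; apply: differentiableD; apply: differentiableM => //;
    apply: (differentiable_Xder (U := U)) => //; exact: UP.
have [dYFr YYF] := fder _ _ Ir dYF.
have D2E : D1 (D1 (F \o P^~ th)) r = Y (Y F) (P r th).
  by rewrite /D1 derive1E -YYF; apply/esym/near_eq_derive.
rewrite PhiE.
have dXu (X : V -> V) : (forall i j q, differentiable (fun q => X q i j) q) ->
    differentiable (Xder X u) (P r th).
  by move=> dX; apply: (differentiable_Xder (U := U)) => //; exact: UP.
have dXF (X : V -> V) : (forall i j q, differentiable (fun q => X q i j) q) ->
    differentiable (Xder X F) (P r th).
  by move=> dX; apply: (differentiable_Xder (U := U)) => //; exact: UP.
(* The outer [Xhat] takes ambient derivatives, so [Xhat F] must be differentiable in the whole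
   space; the square root is harmless since [hnorm] is nonzero at this point. *)
have dXh : differentiable (Xhat X1 X2 u F) (P r th).
  have hnr : hnorm X1 X2 u (P r th) != 0 by rewrite hn // normr_eq0 N0.
  apply: differentiableM; first by
    apply: differentiableB; apply: differentiableM; first [exact: dXu|exact: dXF].
  apply: differentiableV => //; apply: differentiable_sqrt; last first.
    by rewrite -sqrtr_gt0 lt0r hnr sqrtr_ge0.
  apply: differentiableD.
    exact: (differentiableM (dXu _ dX1) (dXu _ dX1)).
  exact: (differentiableM (dXu _ dX2) (dXu _ dX2)).
(* [N] is continuous along the leaf and nonzero at [r], so its sign can be treated as a constant
   when differentiating. *)
have sgN : \forall s \near r, Num.sg (N (P s th)) = Num.sg (N (P r th)).
  have dPr1 : differentiable (P^~ th) r.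
    by apply/derivable1_diffP; have [] := dPr r th.
  have cN : (N \o P^~ th) s @[s --> r] --> N (P r th).
    by have := differentiable_continuous (differentiable_comp dPr1 dN).
  have /orP[Nr|Nr] := lt_total (N0 _ Ir).
    near=> s; rewrite !ltr0_sg //; near: s.
    exact: (cvgr_lt _ cN _ Nr).
  near=> s; rewrite !gtr0_sg //; near: s.
  exact: (cvgr_gt _ cN _ Nr).
have sg2 : Num.sg (N (P r th)) * Num.sg (N (P r th)) = 1.
  by rewrite -expr2 sqr_sg N0.
have YXh : Y (Xhat X1 X2 u F) (P r th) = Num.sg (N (P r th)) * Y (Y F) (P r th).
  have [_ <-] := fder _ _ Ir dXh; rewrite -YYF.
  rewrite -deriveMl //; apply: near_eq_derive.
  have := nI _ Ir; apply: filter_app; move: sgN.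
  by apply: filter_app; near=> s => sgs Is /=; rewrite XhatE // sgs.
have main : Delta0 X0 X1 X2 u F (P r th) =
    D1 (D1 (F \o P^~ th)) r + bb r * D1 (F \o P^~ th) r.
  rewrite /Delta0 !XhatE // YXh mulrA sg2 mul1r D2E; congr (_ + _).
  rewrite mulrA -(nbhs_singleton dD1); congr (_ * _).
  rewrite /bS hn // bbE //.
  (* This is [K2] divided by [be r]. Writing [N] as its sign times [|N|] then cancels the norm, and
     the remaining two signs multiply to [1]. *)
  have -> : Xder X0 u (P r th) = al r / be r * N (P r th).
    by rewrite mulrAC K2 // mulrAC mulfV ?mul1r // be0.
  rewrite {1}[N (P r th)]numEsg; have := N0 _ Ir; rewrite -normr_eq0 => nN.
  by rewrite mulrA mulfK // -mulrA sg2 mulr1.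
(* The point is not characteristic: [- sin th * N] and [cos th * N] cannot both vanish. *)
rewrite main; split.
  rewrite X1u // X2u // !mulf_eq0 !negb_or (negPf (N0 _ Ir)) oppr_eq0 /= !andbT.
  have [s0|] := eqVneq (sin th) 0; [right|by left].
  apply/eqP => c0; move: cs1; rewrite s0 c0 expr0n addr0 => /eqP.
  by rewrite eq_sym oner_eq0.
split; first by have [] := fder F r Ir (dF _ (UP _ Ir)).
by split; first exact: (near_eq_derivable dD1).
Unshelve. all: by end_near. Qed.

End PolarChart.

(** * One-parameter subgroups of matrices *)

Section MatrixExponential.
Context {R : realType} {n : nat}.
Implicit Types (A v w : 'M[R]_n.+1) (c d E : R -> 'M[R]_n.+1).

Lemma is_derive_mulmx c d (s : R) v w :
  is_derive s (1 : R) c v -> is_derive s (1 : R) d w ->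
  is_derive s (1 : R) (fun t => c t *m d t) (v *m d s + c s *m w).
Proof.
move=> /is_derive_mxP dc /is_derive_mxP dd; apply/is_derive_mxP => i j.
have -> : (fun t => (c t *m d t) i j) =
    \sum_(l < n.+1) ((fun t => c t i l) * (fun t => d t l j)).
  by apply/funext => t; rewrite mxE fct_sumE.
have -> : (v *m d s + c s *m w) i j =
    \sum_(l < n.+1) (c s i l *: w l j + d s l j *: v i l).
  rewrite !mxE -big_split /=; apply: eq_bigr => l _.
  by rewrite addrC /GRing.scale /= [v i l * _]mulrC.
by apply: is_derive_sum => l; apply: is_deriveM.
Qed.

Lemma is_derive_mx_scale c (a s : R) v :
  is_derive (a * s) (1 : R) c v -> is_derive s (1 : R) (fun t => c (a * t)) (a *: v).
Proof.
move=> /is_derive_mxP dc; apply/is_derive_mxP => i j; rewrite mxE mulrC.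
apply: (@is_derive1_comp _ (fun t => c t i j) ( *%R a)) => //.
by apply: is_derive_eq; rewrite [LHS]mulr1.
Qed.

Lemma is_derive_mx0_cst c (s t : R) : (forall x, is_derive x (1 : R) c 0) -> c s = c t.
Proof.
move=> dc; apply/matrixP => i j.
apply: (@is_derive_0_is_cst _ (fun x => c x i j)) => x.
by have /is_derive_mxP/(_ i j) := dc x; rewrite mxE.
Qed.

Lemma expG_linv A E :
  E 0 = 1 -> (forall t, is_derive t (1 : R) E (E t *m A)) ->
  (forall t, A *m E t = E t *m A) ->
  expG (1 : 'M[R]_n.+1) (linv A) = E 1.
Proof.
move=> E0 dE AE.
(* Every integral curve [c] is cancelled by [E (- t)]: the product has zero derivative. *)
have cEN c : c 0 = 1 -> (forall t, is_derive t (1 : R) c (c t *m A)) ->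
    c 1 *m E (- 1) = 1.
  move=> c0 dc; pose d := (fun t => c t *m E (- t)).
  have <- : d 0 = 1 by rewrite /d c0 oppr0 E0 mul1mx.
  apply: (@is_derive_mx0_cst d) => t.
  have dEN : is_derive t (1 : R) (fun t => E (- t)) (- (E (- t) *m A)).
    have := @is_derive_mx_scale E (-1) t _ (dE _).
    by rewrite scaleN1r mulN1r; under eq_fun do rewrite mulN1r.
  have := is_derive_mulmx (dc t) dEN.
  by rewrite mulmxN -AE mulmxA subrr.
rewrite /expG; apply: get_unique => [|p [c [c0 [dc <-]]]].
  by exists E.
(* Applied to [E] itself, [cEN] makes [E (- 1)] an inverse of [E 1]; so any other solution has the
   same endpoint. *)
have EN := cEN _ E0 dE; have cN := cEN _ c0 dc.
have NE : E (- 1) *m E 1 = 1 by exact: mulmx1C.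
by rewrite -[c 1]mulmx1 -[X in _ *m X]NE mulmxA cN mul1mx.
Qed.

Lemma differentiable_linv A i j (p : 'M[R]_n.+1) :
  differentiable (fun q => linv A q i j) p.
Proof.
have -> : (fun q => linv A q i j) =
    \sum_(l < n.+1) ((fun q : 'M[R]_n.+1 => q i l) * cst (A l j)).
  by apply/funext => q; rewrite /linv mxE fct_sumE.
apply: differentiable_sum => l; apply: differentiableM => //.
exact: differentiable_coord.
Qed.

(** * Groups generated by an anticommuting pair with a common square *)

Section CliffordPair.
Variables (J1 J2 : 'M[R]_n.+1) (eps k : R) (C Sn : R -> R).
Hypotheses (k0 : k != 0) (J11 : J1 * J1 = eps%:A) (J22 : J2 * J2 = eps%:A).
Hypothesis J21 : J2 * J1 = - (J1 * J2).
Hypotheses (C0 : C 0 = 1) (Sn0 : Sn 0 = 0).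
Hypothesis dC : forall x, is_derive x (1 : R) C (k * eps * Sn x).
Hypothesis dSn : forall x, is_derive x (1 : R) Sn (k * C x).
Hypothesis CS : forall x, C x ^+ 2 - eps * Sn x ^+ 2 = 1.

(** Closed form of the exponential of [k r (cos th J1 + sin th J2)]: the direction squares to the
    scalar [eps], so the even and odd parts of the series sum to [C] and [Sn]. *)
Definition clifford_polar (r th : R) : 'M[R]_n.+1 :=
  (C r)%:A + Sn r *: (cos th *: J1 + sin th *: J2).
Notation P := clifford_polar.

Lemma commA_clifford : commA (k *: J1) (k *: J2) = (2 * k ^+ 2) *: (J1 * J2).
Proof.
rewrite /commA -!scalerAl -!scalerAr J21 !scalerN opprK -scalerDr -mulr2n.
by rewrite scalerA -scaler_nat !scalerA; congr (_ *: _); ring.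
Qed.

Lemma clifford_dir_sqr th :
  (cos th *: J1 + sin th *: J2) * (cos th *: J1 + sin th *: J2) = eps%:A.
Proof.
rewrite mulrDl !mulrDr -!scalerAl -!scalerAr J11 J22 J21 !scalerA.
rewrite -[in RHS](mul1r eps) -(cos2Dsin2 th); move: (J1 * J2) => Q.
by apply/matrixP => i j; rewrite !mxE; ring.
Qed.

(** The right-hand side is [k] times [P r th] times the direction; as the direction squares to
    [eps], this multiplication swaps the roles of [C] and [Sn], exactly as [dC] and [dSn] do. *)
Lemma is_derive_clifford_radial r th :
  is_derive r (1 : R) (P^~ th)
    (cos th *: linv (k *: J1) (P r th) + sin th *: linv (k *: J2) (P r th)).
Proof.
have -> : cos th *: linv (k *: J1) (P r th) + sin th *: linv (k *: J2) (P r th)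
   = (k * eps * Sn r)%:A + (k * C r) *: (cos th *: J1 + sin th *: J2).
  transitivity (k *: (P r th * (cos th *: J1 + sin th *: J2))).
    by rewrite /linv !mulmxE mulrDr -!scalerAr scalerDr !scalerA ![k * _]mulrC.
  rewrite /P mulrDl -!scalerAl mul1r clifford_dir_sqr scalerDr !scalerA addrC.
  by congr (_%:A + _); rewrite [RHS]mulrAC.
apply/is_derive_mxP => i j.
have -> : (fun r => P r th i j) = 
  (C * cst ((1 : 'M[R]_n.+1) i j) + Sn * cst ((cos th *: J1 + sin th *: J2) i j)).
  by apply/funext => x; rewrite /P !mxE.
apply: is_derive_eq.
rewrite !mxE /cst /= !scaler0 !add0r /GRing.scale /=; ring.
Qed.

(** Put [J = cos th J1 + sin th J2] and [J' = - sin th J1 + cos th J2]. The inverse of [P] is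
    [C - Sn J] and [J J' = J1 J2], so translating [d_th P = Sn J'] back to the identity gives
    [Sn C J' - Sn^2 J1 J2]. The factors [1 / k] and [1 / (2 k^2)] come from rescaling the generators
    and their commutator. *)
Lemma is_derive_clifford_angular r th :
  is_derive th (1 : R) (P r)
    ((Sn r * C r / k) *: (- sin th *: linv (k *: J1) (P r th)
                          + cos th *: linv (k *: J2) (P r th))
      + (- (Sn r ^+ 2 / (2 * k ^+ 2))) *:
          linv (commA (k *: J1) (k *: J2)) (P r th)).
Proof.
set v := (X in is_derive _ _ _ X).
have -> : v = Sn r *: (- sin th *: J1 + cos th *: J2).
  have J1Q : J1 * (J1 * J2) = eps *: J2 by rewrite mulrA J11 -scalerAl mul1r.
  have J2Q : J2 * (J1 * J2) = - eps *: J1.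
    by rewrite mulrA J21 mulNr -mulrA J22 -scalerAr mulr1 scaleNr.
  (* Expanding with the relations alone leaves both Pythagorean identities visible: [CS] makes the
     first coefficient [Sn r], and the circular one kills the second. *)
  have -> : v = (Sn r * (C r ^+ 2 - eps * Sn r ^+ 2)) *: (- sin th *: J1 + cos th *: J2)
      + (C r * Sn r ^+ 2 * (cos th ^+ 2 + sin th ^+ 2 - 1)) *: (J1 * J2).
    have -> : v = P r th * ((Sn r * C r) *: (- sin th *: J1 + cos th *: J2)
        - Sn r ^+ 2 *: (J1 * J2)).
      rewrite /v commA_clifford /linv -!mulmxE mulmxBr -!scalemxAr mulmxDr -!scalemxAr.
      (* Making the products opaque keeps [mxE] from expanding them into sums, so that the entries
         obey a scalar identity. *)
      move: (P r th *m _) (P r th *m _) (P r th *m _) => A B D.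
      by apply/matrixP => i j; rewrite !mxE; field.
    rewrite /P -mulmxE mulmxBr.
    do 3 rewrite ?mulmxDl ?mulmxDr -?scalemxAl -?scalemxAr ?mul1mx.
    rewrite !mulmxE ?mul1r.
    rewrite J1Q J2Q J11 J22 J21.
    move: (J1 * J2) => Q.
    apply/matrixP => i j; rewrite !mxE. ring.
  by rewrite CS mulr1 cos2Dsin2 subrr mulr0 scale0r addr0.
apply/is_derive_mxP => i j.
have -> : (fun t => P r t i j) = cst (C r * (1 : 'M[R]_n.+1) i j)
    + cst (Sn r) * (cos * cst (J1 i j) + sin * cst (J2 i j)).
  by apply/funext => t; rewrite /P !mxE.
apply: is_derive_eq.
rewrite !mxE /cst /= !scaler0 !add0r /GRing.scale /=; ring.
Qed.


(** The curve [P (r * t) th] in [t] is the one-parameter subgroup with velocity [A]; its value at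
    time [1] is the claimed point. *)
Lemma Phi_clifford r th :
  Phi (1 : 'M[R]_n.+1) (linv (k *: J1)) (linv (k *: J2)) r th = P r th.
Proof.
pose A := r *: (k *: (cos th *: J1 + sin th *: J2)).
have -> : P r th = P (r * 1) th by rewrite mulr1.
rewrite /Phi; transitivity (expG (1 : 'M[R]_n.+1) (linv A)).
  congr expG; apply/funext => p; rewrite /linv !scalemxAr -mulmxDr; congr (_ *m _).
  by rewrite /A !scalerDr !scalerA; congr (_ *: _ + _ *: _); ring.
apply: (@expG_linv A (fun t => P (r * t) th)) => [|t|t].
- by rewrite /P mulr0 C0 Sn0 scale0r addr0 scale1r.
- have -> : P (r * t) th *m A = r *: (cos th *: linv (k *: J1) (P (r * t) th)
      + sin th *: linv (k *: J2) (P (r * t) th)).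
    rewrite /linv !scalemxAr -mulmxDr scalemxAr; congr (_ *m (_ *: _)).
    by rewrite scalerDr !scalerA ![k * _]mulrC.
  exact: is_derive_mx_scale (is_derive_clifford_radial _ _).
- rewrite /A /P -!scalemxAl -!scalemxAr !mulmxE; congr (_ *: (_ *: _)).
  by move: (cos th *: J1 + _) => M; rewrite mulrDl mulrDr -!scalerAl -!scalerAr mul1r mulr1.
Qed.

(** The drift is the quotient of [Sn C / k] by [Sn^2 / (2 k^2)], which is [2 k C / Sn]. *)
Lemma Delta0_claim_clifford (G : set 'M[R]_n.+1) (I : set R) (bb : R -> R)
    (gen : (R -> R) -> R -> R) :
  open I -> (forall r th, I r -> G (P r th)) -> (forall r, I r -> Sn r != 0) ->
  (forall r, I r -> bb r = 2 * k * (C r / Sn r)) ->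
  (forall f r, gen f r = 2^-1 * (D1 (D1 f) r + bb r * D1 f r)) ->
  Delta0_claim (1 : 'M[R]_n.+1) G (linv (commA (k *: J1) (k *: J2)))
    (linv (k *: J1)) (linv (k *: J2)) I bb gen.
Proof.
move=> oI PG S0 bbE genE.
apply: (@Delta0_claim_polar _ _ _ _ _ _ _ _ _ _ _ P
  (fun r => Sn r * C r / k) (fun r => Sn r ^+ 2 / (2 * k ^+ 2))) => //.
- by move=> i j q; exact: differentiable_linv.
- by move=> i j q; exact: differentiable_linv.
- exact: Phi_clifford.
- exact: is_derive_clifford_radial.
- exact: is_derive_clifford_angular.
- by move=> r Ir; rewrite mulf_neq0 ?invr_eq0 ?mulf_neq0 ?expf_neq0 ?S0 ?pnatr_eq0.
- by move=> r Ir; rewrite bbE //; field; rewrite S0 ?k0.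
Qed.

End CliffordPair.
End MatrixExponential.

(** * The Heisenberg group *)

Section Heisenberg.
Context {R : realType}.

Lemma vec3D (a b c a' b' c' : R) :
  vec3 a b c + vec3 a' b' c' = vec3 (a + a') (b + b') (c + c').
Proof. by apply/rowP => i; rewrite !mxE; case: ifP => _ //; case: ifP. Qed.

Lemma vec3Z (l a b c : R) : l *: vec3 a b c = vec3 (l * a) (l * b) (l * c).
Proof. by apply/rowP => i; rewrite !mxE; case: ifP => _ //; case: ifP. Qed.

Lemma is_derive_vec3 (f g h : R -> R) (s a b c : R) :
  is_derive s (1 : R) f a -> is_derive s (1 : R) g b -> is_derive s (1 : R) h c ->
  is_derive s (1 : R) (fun t => vec3 (f t) (g t) (h t)) (vec3 a b c).
Proof.
move=> df dg dh; apply/is_derive_mxP => i j; rewrite mxE.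
under eq_fun do rewrite mxE.
by case: ifP => _ //; case: ifP.
Qed.

Lemma differentiable_vec3 (f g h : 'rV[R]_3 -> R) (p : 'rV[R]_3) i j :
  differentiable f p -> differentiable g p -> differentiable h p ->
  differentiable (fun q => vec3 (f q) (g q) (h q) i j) p.
Proof.
move=> df dg dh; under eq_fun do rewrite mxE.
by case: (j == 0%N :> nat) => //; case: (j == 1%N :> nat).
Qed.

(** Integral curves from the origin are straight lines. For uniqueness, the first two coordinates
    have constant velocity, hence are [a t] and [b t]; the vertical velocity [(b a t - a b t) / 2]
    then vanishes. *)
Lemma Phi_heis (r th : R) :
  Phi (0 : 'rV[R]_3) (@heisX1 R) (@heisX2 R) r th = vec3 (r * cos th) (r * sin th) 0.
Proof.
rewrite /Phi /expG.
set a := r * cos th; set b := r * sin th.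
have fE (p : 'rV[R]_3) : a *: heisX1 p + b *: heisX2 p =
    vec3 a b ((b * pX p - a * pY p) / 2).
  by rewrite /heisX1 /heisX2 !vec3Z vec3D; congr vec3; field.
apply: get_unique => [|p [c [c0 [dc <-]]]].
  exists (fun t => vec3 (a * t) (b * t) 0); split; [|split].
  - by apply/rowP => i; rewrite !mxE !mulr0; case: ifP => _ //; case: ifP.
  - move=> t; rewrite fE.
    have -> : (b * pX (vec3 (a * t) (b * t) 0) - a * pY (vec3 (a * t) (b * t) 0)) / 2 = 0.
      by rewrite /pX /pY !mxE /=; field.
    by apply: is_derive_vec3; apply: is_derive_eq; rewrite [LHS]mulr1.
  - by rewrite !mulr1.
have dcoord i t : is_derive t (1 : R) (fun t => c t 0 i)
   ((vec3 a b ((b * pX (c t) - a * pY (c t)) / 2)) 0 i).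
  by have /is_derive_mxP/(_ 0 i) := dc t; rewrite fE.
have lin (f : R -> R) l : f 0 = 0 -> (forall t, is_derive t (1 : R) f l) ->
    forall t, f t = l * t.
  move=> f0 df t; apply/eqP; rewrite -subr_eq0; apply/eqP.
  have <- : f 0 - l * 0 = 0 by rewrite f0 mulr0 subrr.
  apply: (@is_derive_0_is_cst _ (fun t => f t - l * t)) => s.
  by have := df s => ?; apply: is_derive_eq; rewrite [l *: 1]mulr1 subrr.
have c0i i : c 0 0 i = 0 by rewrite c0 mxE.
have cX t : c t 0 0 = a * t.
  by apply: (lin (fun t => c t 0 0)) => // s; have := dcoord 0 s; rewrite mxE.
have cY t : c t 0 1 = b * t.
  by apply: (lin (fun t => c t 0 1)) => // s; have := dcoord 1 s; rewrite mxE.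
have cZ t : c t 0 2 = 0 * t.
  apply: (lin (fun t => c t 0 2)) => // s; have := dcoord 2 s; rewrite mxE /=.
  by rewrite /pX /pY cX cY; congr is_derive; field.
apply/rowP => i; rewrite mxE.
case: i => [[|[|[|//]]]] Hi /=.
- by rewrite -[RHS]mulr1 -cX; congr (c 1 0 _); exact: val_inj.
- by rewrite -[RHS]mulr1 -cY; congr (c 1 0 _); exact: val_inj.
- by rewrite -[RHS](mul0r 1) -cZ; congr (c 1 0 _); exact: val_inj.
Qed.

Lemma Delta0_claim_heis :
  Delta0_claim (0 : 'rV[R]_3) setT (@heisX0 R) (@heisX1 R) (@heisX2 R)
       `]0, +oo[ (fun r => 2 / r) (@bessel3_gen R).
Proof.
(* Here [al r = r] and [be r = r^2 / 2]: the rotated horizontal field at radius [r] has vertical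
   component [r / 2], which the Reeb term must cancel. *)
apply: (@Delta0_claim_polar _ _ _ _ _ _ _ _ _ _ _
  (fun r th => vec3 (r * cos th) (r * sin th) 0) id (fun r => r ^+ 2 / 2)) => //.
- move=> i j q; apply: differentiable_vec3 => //.
  apply: differentiableM => //; apply: differentiableN; exact: differentiable_coord.
- move=> i j q; apply: differentiable_vec3 => //.
  apply: differentiableM => //; exact: differentiable_coord.
- exact: Phi_heis.
- move=> r th; rewrite /heisX1 /heisX2 !vec3Z vec3D /pX /pY !mxE /=.
  by apply: is_derive_vec3; apply: is_derive_eq; rewrite /GRing.scale /=; field.
- move=> r th; rewrite /heisX0 /heisX1 /heisX2 !(vec3D, vec3Z) /pX /pY !mxE /=.
  have cs := cos2Dsin2 th.
  apply: is_derive_vec3; apply: is_derive_eq; rewrite /GRing.scale /=; try ring.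
  transitivity (r ^+ 2 / 2 * (cos th ^+ 2 + sin th ^+ 2 - 1)); last by field.
  by rewrite cs subrr mulr0.
- by move=> r; rewrite /= in_itv andbT => r0; rewrite mulf_neq0 ?expf_neq0 ?gt_eqF.
- move=> r; rewrite /= in_itv andbT => r0; field; by rewrite gt_eqF.
- by move=> f r; rewrite /bessel3_gen mulrDr !mulrA mulVf ?mul1r ?pnatr_eq0.
Qed.

End Heisenberg.

(** * Two-by-two matrices by entries *)

Lemma mx2P (T : Type) (A B : 'M[T]_2) :
  A 0 0 = B 0 0 -> A 0 1 = B 0 1 -> A 1 0 = B 1 0 -> A 1 1 = B 1 1 -> A = B.
Proof.
move=> h00 h01 h10 h11; apply/matrixP => i j.
have ord2 (l : 'I_2) : l = 0 \/ l = 1.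
  by case: l => [[|[|//]]] Hl; [left | right]; exact: val_inj.
by case: (ord2 i) => ->; case: (ord2 j) => ->.
Qed.

Lemma mulmx2E (T : pzRingType) (A B : 'M[T]_2) i j :
  (A * B) i j = A i 0 * B 0 j + A i 1 * B 1 j.
Proof.
rewrite mxE !big_ord_recl big_ord0 addr0.
by congr (_ + A i _ * B _ j); exact: val_inj.
Qed.

Lemma det_mx2 (T : comPzRingType) (A : 'M[T]_2) :
  \det A = A 0 0 * A 1 1 - A 0 1 * A 1 0.
Proof.
rewrite (expand_det_row _ 0) !big_ord_recl big_ord0 addr0 /cofactor !det_mx11 !mxE /=.
rewrite expr0 mul1r expr1 mulN1r mulrN.
by congr (_ * A _ _ - A _ _ * A _ _); exact: val_inj.
Qed.

(** * The group SL(2,R), with hyperbolic functions *)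

Section SL2.
Context {R : realType}.
Implicit Type k : R.

Lemma sl2A1E k : sl2A1 k = k *: sl2A1 1.
Proof. by apply: mx2P; rewrite !mxE /=; ring. Qed.

Lemma sl2A2E k : sl2A2 k = k *: sl2A2 1.
Proof. by apply: mx2P; rewrite !mxE /=; ring. Qed.

Lemma sl2A1_sqr : sl2A1 1 * sl2A1 1 = (1 : R)%:A :> 'M[R]_2.
Proof. by apply: mx2P; rewrite mulmx2E !mxE /=; ring. Qed.

Lemma sl2A2_sqr : sl2A2 1 * sl2A2 1 = (1 : R)%:A :> 'M[R]_2.
Proof. by apply: mx2P; rewrite mulmx2E !mxE /=; ring. Qed.

Lemma sl2A_anticomm : sl2A2 1 * sl2A1 1 = - (sl2A1 1 * sl2A2 1) :> 'M[R]_2.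
Proof. by apply: mx2P; rewrite mulmx2E [RHS]mxE mulmx2E !mxE /=; ring. Qed.

Lemma Delta0_claim_SL2 k : 0 < k ->
  Delta0_claim (1 : 'M[R]_2) (@SL2 R)
       (linv (commA (sl2A1 k) (sl2A2 k))) (linv (sl2A1 k)) (linv (sl2A2 k))
       `]0, +oo[
       (fun r => 2 * k * ((expR (k * r) + expR (- (k * r))) /
                          (expR (k * r) - expR (- (k * r)))))
       (hypbessel3_gen k).
Proof.
move=> k0; have kN0 : k != 0 by rewrite gt_eqF.
(* [C] and [Sn] are the hyperbolic cosine and sine of [k x]. *)
pose C (x : R) := (expR (k * x) + expR (- (k * x))) / 2.
pose Sn (x : R) := (expR (k * x) - expR (- (k * x))) / 2.
have ee (x : R) : expR (k * x) * expR (- (k * x)) = 1 by rewrite -expRD subrr expR0.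
have CS (x : R) : C x ^+ 2 - 1 * Sn x ^+ 2 = 1.
  by rewrite /C /Sn -[RHS](ee x); field.
have de (a x : R) : is_derive x (1 : R) (fun t => expR (a * t)) (a * expR (a * x)).
  rewrite mulrC; apply: (@is_derive1_comp _ expR ( *%R a)).
  by apply: is_derive_eq; rewrite [LHS]mulr1.
have deN (x : R) : is_derive x (1 : R) (fun t => expR (- (k * t))) (- k * expR (- (k * x))).
  by rewrite -mulNr; under eq_fun do rewrite -mulNr; exact: de.
have dC (x : R) : is_derive x (1 : R) C (k * 1 * Sn x).
  have d1 := de k x; have d2 := deN x; rewrite /C /Sn.
  by apply: is_derive_eq; rewrite ?scaler0 ?add0r /GRing.scale /=; field.
have dSn (x : R) : is_derive x (1 : R) Sn (k * C x).
  have d1 := de k x; have d2 := deN x; rewrite /C /Sn.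
  by apply: is_derive_eq; rewrite ?scaler0 ?add0r /GRing.scale /=; field.
have S0 (r : R) : 0 < r -> expR (k * r) - expR (- (k * r)) != 0.
  move=> r0; rewrite subr_eq0 gt_eqF // ltr_expR.
  by have := mulr_gt0 k0 r0; lra.
rewrite (sl2A1E k) (sl2A2E k).
apply: (@Delta0_claim_clifford _ _ _ _ 1 k C Sn) => //.
- exact: sl2A1_sqr.
- exact: sl2A2_sqr.
- exact: sl2A_anticomm.
- by rewrite /C mulr0 oppr0 expR0; field.
- by rewrite /Sn mulr0 oppr0 expR0 subrr mul0r.
(* The determinant of the chart is [C^2 - Sn^2 (cos^2 th + sin^2 th)], which is [1] by [CS]. *)
- move=> r th _; rewrite /SL2 /= det_mx2 /clifford_polar !mxE /=.
  rewrite -[RHS](CS r); have -> : Sn r ^+ 2 = Sn r ^+ 2 * (cos th ^+ 2 + sin th ^+ 2).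
    by rewrite cos2Dsin2 mulr1.
  ring.
- by move=> r; rewrite /= in_itv andbT => /S0 ?; rewrite mulf_neq0.
- move=> r; rewrite /= in_itv andbT => /S0 ?; congr (_ * _).
  by rewrite /C /Sn; field.
- by move=> f r; rewrite /hypbessel3_gen mulrDr !mulrA mulVf ?mul1r ?pnatr_eq0.
Qed.

End SL2.

(** * The group SU(2), with circular functions *)

Section SU2.
Context {R : realType}.
Implicit Type k : R.
Import complex.
Local Open Scope complex_scope.

(** Among the generators, ['i *: pauli1] is purely imaginary with imaginary part [su2B], while
    ['i *: pauli2] is the real matrix [su2D]. Realified, they occupy the off-diagonal and the
    diagonal blocks respectively. *)
Definition su2B : 'M[R]_2 := \matrix_(i < 2, j < 2) (if i == j then 0 else 1).
Definition su2D : 'M[R]_2 := \matrix_(i < 2, j < 2)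
  (if i == j then 0 else if i == 0 :> nat then 1 else -1).

Lemma realifyE (A B : 'M[R]_2) (M : 'M[R[i]]_2) :
  (forall i j, M i j = A i j +i* B i j) -> realify M = block_mx A (- B) B A.
Proof.
move=> ME; rewrite /realify.
have -> : map_mx (@Re R) M = A by apply/matrixP => i j; rewrite mxE ME.
by have -> : map_mx (@Im R) M = B by apply/matrixP => i j; rewrite mxE ME.
Qed.

Lemma su2A1E k : su2A1 k = k *: block_mx 0 (- su2B) su2B 0.
Proof.
rewrite /su2A1 (@realifyE 0 (k *: su2B)); last first.
  move=> i j; rewrite !mxE; case: eqP => _; rewrite ?mulr0 ?mulr1 //.
  by apply/eqP; rewrite eq_complex /= !(mul0r, mulr0, mulr1, subr0, addr0) !eqxx.
by rewrite scale_block_mx scaler0 scalerN.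
Qed.

Lemma su2A2E k : su2A2 k = k *: block_mx su2D 0 0 su2D.
Proof.
rewrite /su2A2 (@realifyE (k *: su2D) 0); last first.
  move=> i j; rewrite !mxE; case: eqP => _; rewrite ?mulr0 //.
  by case: ifP => _; apply/eqP; rewrite eq_complex /=; apply/andP; split; apply/eqP; ring.
by rewrite scale_block_mx scaler0 oppr0.
Qed.

Lemma su2B_sqr : su2B *m su2B = 1.
Proof. by apply: mx2P; rewrite mulmx2E !mxE /=; ring. Qed.

Lemma su2D_sqr : su2D *m su2D = - 1.
Proof. by apply: mx2P; rewrite mulmx2E !mxE /=; ring. Qed.

Lemma su2DB : su2D *m su2B = - (su2B *m su2D).
Proof. by apply: mx2P; rewrite mulmx2E [RHS]mxE mulmx2E !mxE /=; ring. Qed.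

Definition su2J1 : 'M[R]_4 := block_mx 0 (- su2B) su2B 0.
Definition su2J2 : 'M[R]_4 := block_mx su2D 0 0 su2D.

(* [mulmx_block] and its siblings do not match at dimension [4], which is [2 + 2]
   only up to conversion. *)
Lemma mulmx_block2 (A B C D A' B' C' D' : 'M[R]_2) :
  (block_mx A B C D : 'M[R]_4) * (block_mx A' B' C' D' : 'M[R]_4) =
  block_mx (A *m A' + B *m C') (A *m B' + B *m D')
           (C *m A' + D *m C') (C *m B' + D *m D').
Proof. exact: (@mulmx_block R 2 2 2 2 2 2 A B C D A' B' C' D'). Qed.

Lemma add_block_mx2 (A B C D A' B' C' D' : 'M[R]_2) :
  (block_mx A B C D : 'M[R]_4) + (block_mx A' B' C' D' : 'M[R]_4) =
  block_mx (A + A') (B + B') (C + C') (D + D').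
Proof. exact: (@add_block_mx R 2 2 2 2 A B C D A' B' C' D'). Qed.

Lemma scale_block_mx2 (a : R) (A B C D : 'M[R]_2) :
  a *: (block_mx A B C D : 'M[R]_4) =
  block_mx (a *: A) (a *: B) (a *: C) (a *: D).
Proof. exact: (@scale_block_mx R 2 2 2 2 a A B C D). Qed.

Lemma scalar_mx4 (a : R) : a%:A = block_mx (a%:M : 'M[R]_2) 0 0 a%:M :> 'M[R]_4.
Proof. by rewrite -scalar_mx_block scalemx1. Qed.

Lemma su2J1_sqr : su2J1 * su2J1 = (-1 : R)%:A.
Proof.
rewrite /su2J1 /su2J2 scalar_mx4 mulmx_block2 !(mul0mx, mulmx0, add0r, addr0).
by rewrite mulNmx mulmxN su2B_sqr raddfN.
Qed.

Lemma su2J2_sqr : su2J2 * su2J2 = (-1 : R)%:A.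
Proof.
rewrite /su2J1 /su2J2 scalar_mx4 mulmx_block2 !(mul0mx, mulmx0, add0r, addr0).
by rewrite su2D_sqr raddfN.
Qed.

Lemma su2J_anticomm : su2J2 * su2J1 = - (su2J1 * su2J2).
Proof.
rewrite /su2J1 /su2J2 !mulmx_block2 !(mul0mx, mulmx0, add0r, addr0) -[RHS]scaleN1r.
by rewrite scale_block_mx2 scaler0 !scaleN1r mulmxN mulNmx su2DB !opprK.
Qed.

Lemma SU2_clifford_polar (C S c s : R) :
  C ^+ 2 + S ^+ 2 = 1 -> c ^+ 2 + s ^+ 2 = 1 ->
  SU2 (C%:A + S *: (c *: su2J1 + s *: su2J2)).
Proof.
move=> CS cs.
(* The complex matrix [C + S (c i sigma1 + s i sigma2)], split into real and imaginary parts.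
   Unitarity and determinant [1] both reduce to [CScs]. *)
pose M : 'M[R[i]]_2 := \matrix_(i, j)
  ((C *: (1 : 'M[R]_2) + (S * s) *: su2D) i j +i* ((S * c) *: su2B) i j).
have CScs : C ^+ 2 + S ^+ 2 * (c ^+ 2 + s ^+ 2) = 1 by rewrite cs mulr1.
exists M; first split.
- by apply: mx2P; rewrite mulmx2E !mxE /=; apply/eqP; rewrite eq_complex /=;
    apply/andP; split; apply/eqP; rewrite -?[RHS]CScs; ring.
- rewrite det_mx2 !mxE /=; apply/eqP; rewrite eq_complex /=.
  by apply/andP; split; apply/eqP; rewrite -?[RHS]CScs; ring.
rewrite (@realifyE (C *: (1 : 'M[R]_2) + (S * s) *: su2D) ((S * c) *: su2B)).
  rewrite scalar_mx4 /su2J1 /su2J2 !scale_block_mx2 !add_block_mx2 scale_block_mx2.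
  by rewrite add_block_mx2 !(scaler0, addr0, add0r) !scalerA scalemx1 !scalerN.
by move=> i j; rewrite mxE.
Qed.

Lemma Delta0_claim_SU2 k : 0 < k ->
  Delta0_claim (1 : 'M[R]_4) (@SU2 R)
       (linv (commA (su2A1 k) (su2A2 k))) (linv (su2A1 k)) (linv (su2A2 k))
       `]0, pi / k[ (fun r => 2 * k * (cos (k * r) / sin (k * r)))
       (legendre3_gen k).
Proof.
move=> k0; have kN0 : k != 0 by rewrite gt_eqF.
have dk (x : R) : is_derive x (1 : R) ( *%R k) k.
  by apply: is_derive_eq; rewrite [LHS]mulr1.
rewrite (su2A1E k) (su2A2E k).
apply: (@Delta0_claim_clifford _ _ _ _ (-1) k
  (fun x => cos (k * x)) (fun x => sin (k * x))) => //.
- exact: su2J1_sqr.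
- exact: su2J2_sqr.
- exact: su2J_anticomm.
- by rewrite mulr0 cos0.
- by rewrite mulr0 sin0.
- move=> x; have := is_derive1_comp (is_derive_cos (k * x)) (dk x).
  by congr is_derive; ring.
- move=> x; have := is_derive1_comp (is_derive_sin (k * x)) (dk x).
  by rewrite mulrC.
- by move=> x; rewrite mulN1r opprK cos2Dsin2.
- by move=> r th _; apply: SU2_clifford_polar; exact: cos2Dsin2.
(* On this interval [k r] lies strictly between [0] and [pi], so the sine is positive; at [pi / k]
   all leaves meet in minus the identity. *)
- move=> r; rewrite /= in_itv /= => /andP[r0 rk]; rewrite gt_eqF // sin_gt0_pi //.
  by rewrite mulr_gt0 //= mulrC -ltr_pdivlMr.
- by move=> f r; rewrite /legendre3_gen mulrDr !mulrA mulVf ?mul1r ?pnatr_eq0.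
Qed.

End SU2.

(** * The three model spaces together, by the sign of [kappa] *)

Theorem theorem1p5 (R : realType) (kappa k : R) :
  (kappa != 0 -> 0 < k /\ `|kappa| = 4 * k ^+ 2) ->
  (kappa = 0 ->
     Delta0_claim (0 : 'rV[R]_3) setT (@heisX0 R) (@heisX1 R) (@heisX2 R)
       `]0, +oo[ (fun r => 2 / r) (@bessel3_gen R)) /\
  (0 < kappa ->
     Delta0_claim (1 : 'M[R]_4) (@SU2 R)
       (linv (commA (su2A1 k) (su2A2 k))) (linv (su2A1 k)) (linv (su2A2 k))
       `]0, pi / k[ (fun r => 2 * k * (cos (k * r) / sin (k * r)))
       (legendre3_gen k)) /\
  (kappa < 0 ->
     Delta0_claim (1 : 'M[R]_2) (@SL2 R)
       (linv (commA (sl2A1 k) (sl2A2 k))) (linv (sl2A1 k)) (linv (sl2A2 k))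
       `]0, +oo[
       (fun r => 2 * k * ((expR (k * r) + expR (- (k * r))) /
                          (expR (k * r) - expR (- (k * r)))))
       (hypbessel3_gen k)).
Proof.
move=> hk; split; [move=> _|split=> kappa0].
- exact: Delta0_claim_heis.
- by have [k0 _] := hk (lt0r_neq0 kappa0); exact: Delta0_claim_SU2.
- by have [k0 _] := hk (ltr0_neq0 kappa0); exact: Delta0_claim_SL2.
Qed.
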